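(* Let $A$ be a complex antidiagonal matrix of size $n$ in standard form with entries $a_1,\dots,a_n$. Then, as multisets (eigenvalues with algebraic multiplicity), $$\mathrm{spec}(A)=\begin{cases}\{-\sqrt{a_1}\sqrt{a_2},\ \sqrt{a_1}\sqrt{a_2},\ \dots,\ -\sqrt{a_{n-1}}\sqrt{a_n},\ \sqrt{a_{n-1}}\sqrt{a_n}\} & n\text{ even},\\ \{a_1,\ -\sqrt{a_2}\sqrt{a_3},\ \sqrt{a_2}\sqrt{a_3},\ \dots,\ -\sqrt{a_{n-1}}\sqrt{a_n},\ \sqrt{a_{n-1}}\sqrt{a_n}\} & n\text{ odd},\end{cases}$$ $$\det A=(-1)^{\lfloor n/2\rfloor}a_1\cdots a_n=(-1)^{\frac{n(n-1)}{2}}a_1\cdots a_n,$$ $$\mathrm{tr}(A)=\begin{cases}0&n\text{ even}\\ a_1&n\text{ odd}\end{cases}\ =\ -\tfrac12 a_1\big((-1)^n-1\big).$$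
   Context: An antidiagonal matrix has nonzero entries only at positions $(i,n+1-i)$. Standard form: for $n=2m$, $A_{m+1-j,\,m+j}=a_{2j-1}$ and $A_{m+j,\,m+1-j}=a_{2j}$ for $1\le j\le m$; for $n=2m+1$, $A_{m+1,m+1}=a_1$, $A_{m+1-j,\,m+1+j}=a_{2j+1}$ and $A_{m+1+j,\,m+1-j}=a_{2j}$ for $1\le j\le m$. For each $k$, $\sqrt{a_k}$ is a fixed choice of complex square root. *)

(* Defs.v *)
From mathcomp Require Import all_boot all_order all_algebra.
From mathcomp Require Import complex.
From mathcomp Require Import reals.
Set Implicit Arguments.
Unset Strict Implicit.
Unset Printing Implicit Defensive.
Import Order.TTheory GRing.Theory Num.Theory.
Local Open Scope ring_scope.

(* Multisets are sequences considered up to [perm_eq].  [spec A] lists the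
   eigenvalues of A with algebraic multiplicity, as the roots of the
   characteristic polynomial; see [mem_spec] and [count_mem_spec]. *)
Definition spec (C : closedFieldType) (n : nat) (A : 'M[C]_n) : seq C :=
  sval (closed_field_poly_normal (char_poly A)).

Lemma char_poly_spec (C : closedFieldType) (n : nat) (A : 'M[C]_n) :
  char_poly A = \prod_(x <- spec A) ('X - x%:P).
Proof.
rewrite /spec; case: closed_field_poly_normal => r /= {1}->.
by rewrite (monicP (char_poly_monic A)) scale1r.
Qed.

Lemma mem_spec (C : closedFieldType) (n : nat) (A : 'M[C]_n) (x : C) :
  (x \in spec A) = eigenvalue A x.
Proof. by rewrite eigenvalue_root_char char_poly_spec root_prod_XsubC. Qed.

Lemma count_mem_spec (C : closedFieldType) (n : nat) (A : 'M[C]_n) (x : C) :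
  count_mem x (spec A) = mup x (char_poly A).
Proof. by rewrite char_poly_spec mu_prod_XsubC. Qed.

(* Matrix indices are 0-based, whereas the definitions below follow the usual
   1-based numbering of rows, columns and entries, whence p.+1 and q.+1. *)
Definition antidiagonal (C : nmodType) (n : nat) (A : 'M[C]_n) : Prop :=
  forall p q : 'I_n, A p q != 0 -> (q.+1 = n.+1 - p.+1)%N.

Definition entry_is (C : Type) (n : nat) (A : 'M[C]_n) (i j : nat) (c : C) :=
  forall p q : 'I_n, p.+1 = i -> q.+1 = j -> A p q = c.

(* Only a 1, ..., a n are relevant. *)
Definition standard_form (C : nmodType) (n : nat) (A : 'M[C]_n) (a : nat -> C) :
    Prop :=
  let m := n./2 in
  antidiagonal A /\
  if odd n then
    entry_is A m.+1 m.+1 (a 1%N) /\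
    forall j, (1 <= j <= m)%N ->
      entry_is A (m + 1 - j) (m + 1 + j) (a (2 * j + 1)%N) /\
      entry_is A (m + 1 + j) (m + 1 - j) (a (2 * j)%N)
  else
    forall j, (1 <= j <= m)%N ->
      entry_is A (m + 1 - j) (m + j) (a (2 * j - 1)%N) /\
      entry_is A (m + j) (m + 1 - j) (a (2 * j)%N).

(* Main.v *)
(** Deleting the first and last rows and columns of a standard-form matrix of
    size n + 2 leaves the standard-form matrix of size n with the same
    a_1, ..., a_n, while the two deleted entries are a_(n+1) and a_(n+2).
    Laplace expansion along the first and last rows thus peels off a factor
    - a_(n+1) a_(n+2) from det A and X^2 - a_(n+1) a_(n+2) from the
    characteristic polynomial. *)

Require Import Defs.
From mathcomp Require Import all_boot all_order all_algebra.
From mathcomp Require Import complex.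
From mathcomp Require Import reals.
From mathcomp Require Import zify ring.
Import Order.TTheory GRing.Theory Num.Theory.
Local Open Scope ring_scope.

Set Implicit Arguments.
Unset Strict Implicit.

(** Composed of two [lift]s, so that the minors left by two successive cofactor expansions unfold to
    [core_mx], up to the order of the two deletions. *)
Definition inner_ord n (i : 'I_n) : 'I_n.+2 := lift ord0 (lift ord_max i).

Definition core_mx (T : Type) n (A : 'M[T]_n.+2) : 'M[T]_n :=
  mxsub (@inner_ord n) (@inner_ord n) A.

Lemma val_inner_ord n (i : 'I_n) : inner_ord i = i.+1 :> nat.
Proof. by rewrite /inner_ord /= /bump /= leqNgt ltn_ord. Qed.

Lemma inner_ord_inj n : injective (@inner_ord n).
Proof. by move=> i j /lift_inj/lift_inj. Qed.

Lemma sum_ord_border (V : nmodType) n (F : 'I_n.+2 -> V) :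
  \sum_i F i = F ord0 + F ord_max + \sum_i F (inner_ord i).
Proof.
rewrite big_ord_recl big_ord_recr /= addrA addrAC; congr (_ + _ + _).
  by congr F; apply: val_inj.
by apply: eq_bigr => i _; congr F; apply: ord_inj; rewrite val_inner_ord.
Qed.

(** Expanding along the first row and then along the last one leaves two terms, one for each
    diagonal of the 2 by 2 block of corners; the inner rows may be arbitrary. *)
Lemma det_border (K : comPzRingType) n (B : 'M[K]_n.+2) :
    (forall i, B ord0 (inner_ord i) = 0) ->
    (forall i, B ord_max (inner_ord i) = 0) ->
  \det B = (B ord0 ord0 * B ord_max ord_max - B ord0 ord_max * B ord_max ord0)
           * \det (core_mx B).
Proof.
move=> B0 Bmax; rewrite (expand_det_row B ord0) sum_ord_border.
rewrite [X in _ + X]big1 ?addr0 => [|i _]; last by rewrite B0 mul0r.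
have c00 : cofactor B ord0 ord0 = B ord_max ord_max * \det (core_mx B).
  rewrite /cofactor /= expr0 mul1r (expand_det_row _ ord_max) big_ord_recr /=.
  rewrite big1 ?add0r => [|i _].
    rewrite /cofactor addnn -signr_odd odd_double expr0 mul1r !mxE.
    rewrite (_ : lift ord0 ord_max = ord_max :> 'I_n.+2); last exact: ord_inj.
    by congr (_ * \det _); apply/matrixP => i j; rewrite !mxE.
  rewrite !mxE (_ : lift ord0 ord_max = ord_max :> 'I_n.+2); last exact: val_inj.
  rewrite (_ : lift _ _ = inner_ord i) ?Bmax ?mul0r //.
  by apply: ord_inj; rewrite val_inner_ord.
(* The signs [(-1) ^+ n.+1] and [(-1) ^+ n] of the two expansions combine to -1. *)
have c0m : cofactor B ord0 ord_max = - B ord_max ord0 * \det (core_mx B).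
  rewrite /cofactor /= (expand_det_row _ ord_max) big_ord_recl /=.
  rewrite big1 ?addr0 => [|i _].
    rewrite /cofactor /= add0n addn0 !mxE.
    rewrite (_ : lift ord0 ord_max = ord_max :> 'I_n.+2); last exact: ord_inj.
    rewrite (_ : lift ord_max ord0 = ord0 :> 'I_n.+2); last exact: ord_inj.
    have sgnE x y : (-1) ^+ n.+1 * (x * ((-1) ^+ n * y)) = - x * y :> K.
      rewrite mulrCA [X in x * X]mulrA -exprD addSn addnn exprS.
      rewrite -signr_odd odd_double mulr1 mulN1r mulrN.
      by rewrite mulNr.
    rewrite sgnE; congr (_ * \det _); apply/matrixP => i j; rewrite !mxE.
    (* The columns are deleted in the opposite order to [inner_ord], so the indices are compared by
       value. *)
    congr (B _ _); apply: ord_inj.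
    by rewrite val_inner_ord /= /bump /= leqNgt ltnS ltn_ord.
  rewrite !mxE (_ : lift ord0 ord_max = ord_max :> 'I_n.+2); last exact: val_inj.
  rewrite (_ : lift _ _ = inner_ord i) ?Bmax ?mul0r //.
  by apply: ord_inj; rewrite val_inner_ord /= /bump /= ltnNge ltn_ord.
rewrite c00 c0m; ring.
Qed.

Lemma antidiagonal_core (C : nmodType) n (A : 'M[C]_n.+2) :
  antidiagonal A -> antidiagonal (core_mx A).
Proof.
move=> hA p q; rewrite mxE => /hA; rewrite !val_inner_ord; lia.
Qed.

(** Standard form numbers the entries outwards from the centre: passing to the core lowers [m] and
    both coordinates by one, so the condition for each remaining [j] is the same. *)
Lemma standard_form_core (C : nmodType) n (A : 'M[C]_n.+2) a :
  standard_form A a -> standard_form (core_mx A) a.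
Proof.
case=> /antidiagonal_core hA h; split=> //; move: h.
rewrite /= negbK; case: (odd n) => [[h1 h]|h].
- split=> [p q hp hq|j hj]; first by
    rewrite mxE; apply: h1; rewrite val_inner_ord; lia.
  have [|h2 h3] := h j; first lia.
  by split=> p q hp hq; rewrite mxE; [apply: h2|apply: h3];
    rewrite val_inner_ord; lia.
- move=> j hj; have [|h2 h3] := h j; first lia.
  by split=> p q hp hq; rewrite mxE; [apply: h2|apply: h3];
    rewrite val_inner_ord; lia.
Qed.

Lemma antidiagonal_eq0 (C : nmodType) n (A : 'M[C]_n) (p q : 'I_n) :
  antidiagonal A -> (p + q).+1 <> n -> A p q = 0.
Proof.
move=> hA npq; apply/eqP; case: eqVneq => // /hA.
have := ltn_ord p; lia.
Qed.

(** The corners are the outermost pair, at the largest [j]. Their product is used because the parity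
    of [n] decides which corner holds [a n.+1]. *)
Lemma standard_form_corners (C : comPzRingType) n (A : 'M[C]_n.+2) a :
  standard_form A a ->
  A ord0 ord_max * A ord_max ord0 = a n.+1 * a n.+2.
Proof.
case=> _ /=; rewrite negbK.
have en := odd_double_half n; case: (odd n) en => en.
- case=> _ /(_ n./2.+1) []; first lia.
  move=> /(_ ord0 ord_max) -> /=; try lia.
  move=> /(_ ord_max ord0) -> /=; try lia.
  by rewrite mulrC; congr (a _ * a _); lia.
- case/(_ n./2.+1); first lia.
  move=> /(_ ord0 ord_max) -> /=; try lia.
  move=> /(_ ord_max ord0) -> /=; try lia.
  by congr (a _ * a _); lia.
Qed.

Lemma antidiagonal_border (C : nmodType) n (A : 'M[C]_n.+2) :
  antidiagonal A ->
  [/\ A ord0 ord0 = 0, A ord_max ord_max = 0,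
      forall i, A ord0 (inner_ord i) = 0 &
      forall i, A ord_max (inner_ord i) = 0].
Proof.
move=> hA; split=> [||i|i]; apply: antidiagonal_eq0 => //; rewrite ?val_inner_ord /=;
  try have := ltn_ord i; lia.
Qed.

Lemma det_standard_form (K : comPzRingType) n (A : 'M[K]_n) a :
  standard_form A a ->
  \det A = (-1) ^+ n./2 * \prod_(1 <= k < n.+1) a k.
Proof.
elim/ltn_ind: n A => -[|[|n]] IH A hA.
- by rewrite det_mx00 big_nil mulr1.
- case: hA => _ [h _]; rewrite det_mx11 big_nat1 mul1r.
  exact: h.
have [A00 Amm A0 Am] := antidiagonal_border hA.1.
rewrite det_border // (IH n) ?leqnSn //; last exact: standard_form_core.
rewrite A00 (standard_form_corners hA) !(@big_nat_recr _ _ _ _.+1) //= exprS.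
ring.
Qed.

(** Each peeled border has zero diagonal corners, so only a central entry can survive. *)
Lemma trace_standard_form (K : pzRingType) n (A : 'M[K]_n) a :
  standard_form A a -> \tr A = if odd n then a 1%N else 0.
Proof.
elim/ltn_ind: n A => -[|[|n]] IH A hA.
- by rewrite /mxtrace big_ord0.
- by case: hA => _ [h _]; rewrite trace_mx11; apply: h.
have [A00 Amm _ _] := antidiagonal_border hA.1.
rewrite /mxtrace sum_ord_border A00 Amm !add0r /= negbK.
rewrite -(IH n _ (core_mx A)) ?leqnSn //; last exact: standard_form_core.
by apply: eq_bigr => i _; rewrite mxE.
Qed.

(** Leaving the quadratic factors unsplit avoids square roots; the offset [odd n] skips the central
    entry [a 1]. *)
Lemma char_poly_standard_form (K : comNzRingType) n (A : 'M[K]_n) a :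
  standard_form A a ->
  char_poly A = (if odd n then 'X - (a 1%N)%:P else 1) *
    \prod_(j < n./2) ('X^2 - (a (odd n + 2 * j).+1 * a (odd n + 2 * j).+2)%:P).
Proof.
elim/ltn_ind: n A => -[|[|n]] IH A hA.
- by rewrite /char_poly det_mx00 big_ord0 mulr1.
- case: hA => _ [h _]; rewrite /char_poly det_mx11 !mxE big_ord0 mulr1 /=.
  by rewrite (h ord0 ord0).
have [A00 Amm A0 Am] := antidiagonal_border hA.1.
have coreE : core_mx (char_poly_mx A) = char_poly_mx (core_mx A).
  by apply/matrixP => i j; rewrite !mxE (inj_eq (@inner_ord_inj n)).
rewrite [LHS]det_border; first last.
- move=> i; rewrite !mxE Am subr0 -val_eqE /= -[bump 0 _]/(inner_ord i : nat).
  by rewrite val_inner_ord eqSS gtn_eqF.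
- by move=> i; rewrite !mxE A0 subr0.
rewrite coreE -/(char_poly _) (IH n (leqnSn _) _ (standard_form_core hA)).
rewrite /= negbK big_ord_recr /= mulrCA; congr (_ * _).
rewrite mulrC; congr (_ * _).
(* As [odd n + 2 * n./2 = n], the last factor has indices [n.+1] and [n.+2]; the minus signs of the
   two antidiagonal corners cancel. *)
rewrite mul2n odd_double_half -(standard_form_corners hA) polyCM.
by rewrite !mxE A00 Amm /= !subr0 !sub0r mulrNN expr2 eqxx !mulr1n.
Qed.

Lemma prod_opp_pairs (K : comNzRingType) (f : nat -> K) m :
  \prod_(x <- flatten [seq [:: - f j; f j] | j <- iota 1 m]) ('X - x%:P) =
  \prod_(j < m) ('X^2 - (f j.+1 ^+ 2)%:P).
Proof.
rewrite big_flatten big_map (iotaDl 1 0) big_map -{1}[m]subn0.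
rewrite -/(index_iota 0 m) big_mkord; apply: eq_bigr => j _.
by rewrite big_cons big_seq1 add1n polyCN rmorphXn /=; ring.
Qed.

(** A product of monic linear factors determines its multiset of roots, so factoring the
    characteristic polynomial suffices. *)
Lemma spec_eq_roots (C : closedFieldType) n (A : 'M[C]_n) (s : seq C) :
  char_poly A = \prod_(x <- s) ('X - x%:P) -> perm_eq (spec A) s.
Proof. by rewrite char_poly_spec => /prod_XsubC_eq. Qed.

Unset Implicit Arguments.
Set Strict Implicit.

Theorem theorem5p3 (R : realType) (n : nat) (A : 'M[R[i]]_n)
    (a sqrt_a : nat -> R[i])
    (hA : standard_form A a)
    (hsqrt : forall k, (1 <= k <= n)%N -> sqrt_a k ^+ 2 = a k) :
  [/\ perm_eq (spec A)
        (if odd n then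
           a 1%N :: flatten [seq [:: - (sqrt_a (2 * j)%N * sqrt_a (2 * j + 1)%N);
                                   sqrt_a (2 * j)%N * sqrt_a (2 * j + 1)%N]
                          | j <- iota 1 n./2]
         else
           flatten [seq [:: - (sqrt_a (2 * j - 1)%N * sqrt_a (2 * j)%N);
                            sqrt_a (2 * j - 1)%N * sqrt_a (2 * j)%N]
                   | j <- iota 1 n./2]),
      \det A = (-1) ^+ (n %/ 2) * \prod_(1 <= k < n.+1) a k,
      \det A = (-1) ^+ (n * (n - 1) %/ 2) * \prod_(1 <= k < n.+1) a k,
      \tr A = (if odd n then a 1%N else 0)
    & \tr A = - (1 / 2) * a 1%N * ((-1) ^+ n - 1)].
Proof.
have sq k : (0 < k <= n)%N -> sqrt_a k * sqrt_a k = a k.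
  by move/hsqrt; rewrite expr2.
have en := odd_double_half n.
have detE := det_standard_form hA.
have trE := trace_standard_form hA.
split=> //; rewrite ?divn2 //.
- apply: spec_eq_roots; rewrite (char_poly_standard_form hA).
  case: (odd n) en => en.
    rewrite big_cons (prod_opp_pairs (fun j => _ (2 * j)%N * _ (2 * j + 1)%N)).
    congr (_ * _); apply: eq_bigr => j _; have := ltn_ord j => ltj.
    rewrite exprMn !expr2 !sq; try lia.
    by congr (_ - (a _ * a _)%:P); lia.
  rewrite mul1r (prod_opp_pairs (fun j => _ (2 * j - 1)%N * _ (2 * j)%N)).
  apply: eq_bigr => j _; have := ltn_ord j => ltj.
  rewrite exprMn !expr2 !sq; try lia.
  by congr (_ - (a _ * a _)%:P); lia.
(* With m = [n./2], the left side is m(2m - 1) = m + 2m(m - 1) for n = 2m and m(2m + 1) = m + 2mm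
   for n = 2m + 1, so both exponents of -1 have the same parity. *)
- have halfE : (n * (n - 1))./2 = (n./2 + (n./2 * (n./2 - ~~ odd n)).*2)%N.
    rewrite -[RHS]doubleK; congr _./2.
    case: (odd n) en; case: (n./2) => [|m] /= <-; nia.
  by rewrite detE halfE exprD -[X in _ = _ * X * _]signr_odd odd_double mulr1.
(* For odd [n] the last factor is -2, which cancels -1/2; for even [n] it is 0. *)
- rewrite trE -signr_odd; case: (odd n); rewrite ?expr0 ?expr1 ?subrr ?mulr0 //.
  by field.
Qed.
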